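(* Let $\mathcal{R}$ be a commutative ring with a quasi-valuation $\mathsf{e}$, and let $\mathcal{R}^\dag=\{f\in\mathcal{R}\mid \mathsf{e}(fg)=\mathsf{e}(f)+\mathsf{e}(g)\ \forall g\in\mathcal{R}\}$. Let $\mathcal{A}=(\mathcal{A}_{ij})\in\mathcal{R}^{n\times n}$. Assume that $\mathcal{A}$ has $n$ algebraic eigenvalues (counted with multiplicities) and that they all belong to $\mathcal{R}^\dag$. Denote by $\Lambda=(\Lambda_1\le\cdots\le\Lambda_n)$ the sequence of their images by $\mathsf{e}$ (counted with multiplicities). Let $A\in\mathbb{R}_{\min}^{n\times n}$ be such that $\mathsf{e}(\mathcal{A}_{ij})\ge A_{ij}$ for all $i,j\in\{1,\dots,n\}$, and let $\Gamma=(\gamma_1\le\cdots\le\gamma_n)$ be the sequence of min-plus algebraic eigenvalues of $A$. Then $\Lambda$ is weakly (super) majorized by $\Gamma$.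
   Context: A quasi-valuation on a ring $\mathcal{R}$ is a map $\mathsf{e}:\mathcal{R}\to\mathbb{R}\cup\{+\infty\}$ such that $\mathsf{e}(f+g)\ge\min(\mathsf{e}(f),\mathsf{e}(g))$ and $\mathsf{e}(fg)\ge\mathsf{e}(f)+\mathsf{e}(g)$ for all $f,g\in\mathcal{R}$, and $\mathsf{e}(-1)=0$. That $\mathcal{A}$ has $n$ algebraic eigenvalues counted with multiplicities means that its characteristic polynomial $\det(\mathsf{Y}I-\mathcal{A})\in\mathcal{R}[\mathsf{Y}]$ factors as $\prod_{i=1}^n(\mathsf{Y}-\mathcal{L}_i)$ with $\mathcal{L}_i\in\mathcal{R}$; these $\mathcal{L}_i$ are the eigenvalues. $\mathbb{R}_{\min}=\mathbb{R}\cup\{+\infty\}$ is the min-plus semifield, with addition $a\oplus b=\min(a,b)$, multiplication $ab=a+b$ (usual sum), zero element $+\infty$ and unit element $0$. A formal polynomial $P=\bigoplus_{k=0}^n P_k\mathsf{Y}^k$ of degree $n$ over $\mathbb{R}_{\min}$ (so $P_n\ne+\infty$) has associated polynomial function $\widehat P(y)=\min_k(P_k+ky)$, $y\in\mathbb{R}_{\min}$ (the term $k=0$ being $P_0$). It factors uniquely as $\widehat P(y)=P_n+\sum_{i=1}^n\min(y,c_i)$ with $c_1\le\cdots\le c_n$ in $\mathbb{R}_{\min}$; the $c_i$ are the (min-plus) roots of $P$. For $A\in\mathbb{R}_{\min}^{n\times n}$, the min-plus characteristic polynomial is $P_A=\bigoplus_{k=0}^n (P_A)_k\mathsf{Y}^k$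 with $(P_A)_n=0$ and, for $0\le k\le n-1$, $(P_A)_k=\min_{J\subset[n],\,\#J=n-k}\ \min_{\sigma\in\mathfrak{S}_J}\sum_{j\in J}A_{j\sigma(j)}$, where $[n]=\{1,\dots,n\}$ and $\mathfrak{S}_J$ is the set of permutations of $J$. The min-plus algebraic eigenvalues of $A$ are the $n$ roots of $P_A$. For $u,v\in\mathbb{R}_{\min}^n$ with increasingly ordered entries $u_{(1)}\le\cdots\le u_{(n)}$ and $v_{(1)}\le\cdots\le v_{(n)}$, $u$ is weakly (super) majorized by $v$, written $u\prec^{\rm w}v$, if $u_{(1)}+\cdots+u_{(k)}\ge v_{(1)}+\cdots+v_{(k)}$ for all $k=1,\dots,n$ (usual sums in $\mathbb{R}\cup\{+\infty\}$). *)

(* Defs.v *)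
From HB Require Import structures.
From mathcomp Require Import all_boot all_order all_algebra all_fingroup.
From mathcomp Require Import all_classical all_reals.

Set Implicit Arguments.
Unset Strict Implicit.
Unset Printing Implicit Defensive.

Import Order.TTheory GRing.Theory Num.Theory.

Local Open Scope ring_scope.
Local Open Scope ereal_scope.

(* R_min is rendered as the elements of [\bar R] different from [-oo]: there,
   its addition is [mine], its multiplication is [+], and [+] never meets the
   convention [+oo + -oo = -oo]. *)

Record quasi_valuation (R : realType) (K : comNzRingType) (e : K -> \bar R) :
    Prop := QuasiValuation {
  qval_neq_ninfty : forall f, e f != -oo;
  qval_add : forall f g, mine (e f) (e g) <= e (f + g)%R;
  qval_mul : forall f g, e f + e g <= e (f * g)%R;
  qval_opp1 : e (-1)%R = 0
}.

(* the subset written with a dagger exponent *)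
Definition dagger (R : realType) (K : comNzRingType) (e : K -> \bar R) :
    set K :=
  [set f | forall g, e (f * g)%R = e f + e g].

(* [tnth L] enumerates n algebraic eigenvalues of [M], with multiplicities. *)
Definition algebraic_eigenvalues (K : comNzRingType) (n : nat) (M : 'M[K]_n)
    (L : n.-tuple K) : Prop :=
  char_poly M = (\prod_(i < n) ('X - (tnth L i)%:P))%R.

(* A formal min-plus polynomial of degree n is given by its coefficients
   [P : 'I_n.+1 -> \bar R], with [P ord_max != +oo]; note that [y *+ 0 = 0]
   even for [y = +oo]. *)
Definition minplus_eval (R : realType) (n : nat) (P : 'I_n.+1 -> \bar R)
    (y : \bar R) : \bar R :=
  \big[mine/+oo]_(k < n.+1) (P k + y *+ k).

Definition minplus_roots (R : realType) (n : nat) (P : 'I_n.+1 -> \bar R)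
    (c : n.-tuple (\bar R)) : Prop :=
  [/\ P ord_max != +oo,
      sorted <=%O c,
      forall i, tnth c i != -oo
    & forall y, y != -oo ->
        minplus_eval P y = P ord_max + \sum_(i < n) mine y (tnth c i)].

(* A permutation of J is a permutation of 'I_n with support in J. *)
Definition minplus_char_poly (R : realType) (n : nat) (A : 'M[\bar R]_n)
    (k : 'I_n.+1) : \bar R :=
  if k == ord_max then 0
  else \big[mine/+oo]_(J : {set 'I_n} | #|J| == (n - k)%N)
         \big[mine/+oo]_(s : {perm 'I_n} | perm_on J s)
           \sum_(j in J) A j (s j).

Definition minplus_eigenvalues (R : realType) (n : nat) (A : 'M[\bar R]_n)
    (c : n.-tuple (\bar R)) : Prop :=
  minplus_roots (minplus_char_poly A) c.

Definition weakly_majorized (R : realType) (n : nat)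
    (u v : n.-tuple (\bar R)) : Prop :=
  forall k : nat, (1 <= k <= n)%N ->
    \sum_(i < n | (i < k)%N) tnth (sort_tuple <=%O v) i
      <= \sum_(i < n | (i < k)%N) tnth (sort_tuple <=%O u) i.

(* Main.v *)
(* Weak majorization of sorted sequences follows from the inequality
   [sum_i min(y, gamma_i) <= sum_i min(y, Lambda_i)] at every real y.  Its
   left-hand side is the min-plus characteristic polynomial of A at y, which is
   at most [e(p_k) + k y] for each coefficient p_k of det(Y I - M): p_k is, up
   to signs, a sum of products of entries of M indexed by permutations of the
   sets J of cardinal n - k.  Dividing out the factors Y - l one at a time, as
   in a Gauss lemma, the minimum over k of [e(p_k) + k y] is at most
   [sum_i min(y, e(l_i))]. *)
Require Import Defs.
From HB Require Import structures.
From mathcomp Require Import all_boot all_order all_algebra all_fingroup.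
From mathcomp Require Import all_classical all_reals.
From mathcomp Require Import lra.

Set Implicit Arguments.
Unset Strict Implicit.
Unset Printing Implicit Defensive.

Import Order.TTheory GRing.Theory Num.Theory.

Local Open Scope ring_scope.
Local Open Scope ereal_scope.

Section QuasiValuation.
Variables (R : realType) (K : comNzRingType) (e : K -> \bar R).
Hypothesis he : quasi_valuation e.

Lemma qvalN f : e (- f)%R = e f.
Proof.
have le_N g : e g <= e (- g)%R.
  by have := qval_mul he (-1)%R g; rewrite (qval_opp1 he) add0e mulN1r.
by apply/le_anti; rewrite le_N -{2}[f]opprK le_N.
Qed.

Lemma qval_le0 f : e f <= e 0%R.
Proof.
by have := qval_add he f (- f)%R; rewrite qvalN subrr minEle lexx.
Qed.

Lemma qval1 : e 1%R = 0.
Proof. by rewrite -qvalN (qval_opp1 he). Qed.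

(** A quasi-valuation may be finite at 0, so the value of an empty sum needs its own bound
    [c <= e 0]. *)
Lemma qval_sum (I : finType) (P : pred I) (F : I -> K) (c : \bar R) :
  c <= e 0%R -> (forall i, P i -> c <= e (F i)) ->
  c <= e (\sum_(i | P i) F i)%R.
Proof.
move=> c0 cF; elim/big_rec: _ => // i x /cF cFi cx.
by apply: le_trans (qval_add he _ _); rewrite le_min cFi.
Qed.

Lemma qval_prod (I : finType) (P : pred I) (F : I -> K) (a : I -> \bar R) :
  (forall i, P i -> a i <= e (F i)) ->
  \sum_(i | P i) a i <= e (\prod_(i | P i) F i)%R.
Proof.
move=> aF; elim/big_rec2: _ => [|i x z /aF aFi zx]; first by rewrite qval1.
by apply: le_trans (qval_mul he _ _); rewrite leeD.
Qed.

Lemma qval_coef_sign (m k : nat) (p : {poly K}) :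
  e ((-1) ^+ m * p)%R`_k = e p`_k.
Proof. by rewrite -signr_odd mulr_sign; case: odd; rewrite ?coefN ?qvalN. Qed.

(* Weighting the indeterminate by [y], this is the inequality
   [e_y q + min y (e l) >= e_y (('X - l) * q)] of a Gauss lemma.  When [y <= e l]
   the coefficients of [q] are recovered from the top one down, and otherwise
   from the bottom one up, dividing by [l]. *)
Lemma qval_coef_divXsubC (y c : R) (l : K) (q : {poly K}) (n : nat) :
  dagger e l -> (size q <= n.+1)%N ->
  (forall k, (k <= n.+1)%N ->
    c%:E + mine y%:E (e l) <= e (('X - l%:P) * q)%R`_k + (y *+ k)%:E) ->
  forall k, (k <= n)%N -> c%:E <= e q`_k + (y *+ k)%:E.
Proof.
move=> ldag sq Hc.
have coefE k : (('X - l%:P) * q)%R`_k.+1 = (q`_k - l * q`_k.+1)%R.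
  by rewrite mulrBl coefB coefXM coefCM.
have coef0 : (('X - l%:P) * q)%R`_0 = (- (l * q`_0))%R.
  by rewrite mulrBl coefB coefXM coefCM sub0r.
case: (leP y%:E (e l)) => [yl|ly] in Hc *.
- have Hc1 k : (k <= n)%N -> c%:E <= e (q`_k - l * q`_k.+1)%R + (y *+ k)%:E.
    move=> kn; have := Hc k.+1 kn; rewrite coefE mulrS.
    by case: (e _) => [a||] //=; rewrite ?leey // -!EFinD !lee_fin; lra.
  suff H j k : (k + j)%N = n -> c%:E <= e q`_k + (y *+ k)%:E.
    by move=> k kn; apply: (H (n - k)%N); rewrite subnKC.
  elim: j k => [|j IH] k kj.
    have := Hc1 k; rewrite (nth_default _ (_ : size q <= k.+1)%N); last first.
      by rewrite -[k]addn0 kj.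
    by rewrite mulr0 subr0; apply; rewrite -kj leq_addr.
  have := IH k.+1; rewrite addSnnS => /(_ kj); rewrite mulrS.
  have /Hc1 : (k <= n)%N by rewrite -kj leq_addr.
  (* Here [q_k] is the sum of [q_k - l q_(k+1)], bounded by [Hc1], and [l q_(k+1)], of value at
     least [y + e q_(k+1)]. *)
  have := qval_add he (q`_k - l * q`_k.+1)%R (l * q`_k.+1)%R.
  rewrite subrK ldag ge_min => /orP H.
  have := qval_neq_ninfty he l; have := qval_neq_ninfty he q`_k.+1.
  have := qval_neq_ninfty he q`_k; move: yl H.
  case: (e l) => [b||] //; case: (e q`_k.+1) => [q1||] //;
  case: (e q`_k) => [q0||] //; case: (e _) => [a||] //= + + _ _ _;
  rewrite -?EFinD ?lee_fin ?leey ?leye_eq ?leeNy_eq //= => + [] //;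
  lra.
- have [b lb] : exists b, e l = b%:E.
    by have := qval_neq_ninfty he l; case: (e l) ly => // b; exists b.
  move: ly; rewrite lb lte_fin => ly.
  have lq g : e (l * g)%R = b%:E + e g by rewrite ldag lb.
  elim=> [_|k IH kn].
    have := Hc 0%N isT; rewrite coef0 qvalN lq lb !mulr0n.
    by case: (e _) => [a||] //=; rewrite ?leey // -!EFinD !lee_fin; lra.
  have := Hc k.+1 (leqW kn); rewrite coefE lb mulrS.
  have := IH (ltnW kn).
  (* Bounding [l q_(k+1) = q_k - (q_k - l q_(k+1))] is enough: its value is [b + e q_(k+1)] and the
     finite [b] cancels. *)
  have := qval_add he q`_k (- (q`_k - l * q`_k.+1))%R.
  rewrite qvalN opprB subrKC lq ge_min => /orP.
  move: (qval_neq_ninfty he q`_k.+1) (qval_neq_ninfty he q`_k).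
  case: (e q`_k.+1) => [q1||] //;
  case: (e q`_k) => [q0||] //; case: (e _) => [a||] //= _ _;
  rewrite -?EFinD ?lee_fin ?leey ?leye_eq ?leeNy_eq //= => -[] //;
  lra.
Qed.

(** Each factor removed subtracts the finite number [min(y, e l)] from [d]; when none is left,
    [e 1 = 0] bounds what remains of [d]. *)
Lemma qval_coef_prodXsubC (y d : R) (s : seq K) :
  (forall l, l \in s -> dagger e l) ->
  (forall k, (k <= size s)%N ->
    d%:E <= e (\prod_(l <- s) ('X - l%:P))%R`_k + (y *+ k)%:E) ->
  d%:E <= \sum_(l <- s) mine y%:E (e l).
Proof.
elim: s d => [|l s IH] d sdag Hd.
  by have := Hd 0%N isT; rewrite !big_nil coef1 /= qval1 add0e mulr0n.
have [r rE] : exists r, mine y%:E (e l) = r%:E.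
  have := qval_neq_ninfty he l.
  case: (e l) => [b||] // _; first by rewrite -EFin_min; eexists.
  by exists y; rewrite minEle leey.
rewrite big_cons rE.
have : (d - r)%:E <= \sum_(l <- s) mine y%:E (e l).
  apply: IH => [l' l's|]; first by apply: sdag; rewrite inE l's orbT.
  apply: (@qval_coef_divXsubC _ _ l); first by apply: sdag; rewrite mem_head.
    by rewrite size_prod_XsubC.
  by move=> k kn; rewrite rE -EFinD subrK; have := Hd k kn; rewrite big_cons.
by rewrite EFinB leeBlDr // addeC.
Qed.

End QuasiValuation.

(* In the expansion of [\prod_i ('X *+ (i == s i) - M i (s i))], choosing the
   term ['X] exactly outside [J] contributes only if [s] is supported in [J]. *)
Lemma qval_coef_char_poly (R : realType) (K : comNzRingType) (e : K -> \bar R)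
    (n : nat) (M : 'M[K]_n) (A : 'M[\bar R]_n) (k : 'I_n.+1) :
  quasi_valuation e -> (forall i j, A i j <= e (M i j)) ->
  minplus_char_poly A k <= e (char_poly M)`_k.
Proof.
move=> he heA; rewrite /minplus_char_poly; case: eqVneq => [->|kn].
  have /monicP := char_poly_monic M.
  by rewrite /lead_coef size_char_poly /= => ->; rewrite (qval1 he).
set c := \big[mine/+oo]_(J | _) _.
have cle (J : {set 'I_n}) (s : 'S_n) : #|J| = (n - k)%N -> perm_on J s ->
    c <= e (\prod_(j in J) M j (s j))%R.
  move=> /eqP cJ sJ; apply: (le_trans (bigmin_le_cond _ _ cJ)).
  apply: (le_trans (bigmin_le_cond _ _ sJ)).
  exact: qval_prod.
(* Vanishing terms of the expansion need this bound. Any set of cardinal [n - k], with the identity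
   permutation, gives it, since [e 0] is the largest value of [e]. *)
have c0 : c <= e 0%R.
  have /card_geqP[t [ut st _]] : (n - k <= #|[set: 'I_n]|)%N.
    by rewrite cardsT card_ord leq_subr.
  have ct : #|[set x in t]| = (n - k)%N by rewrite cardsE (card_uniqP ut).
  exact: le_trans (cle _ 1%g ct (perm_on1 _)) (qval_le0 he _).
rewrite /char_poly /determinant coef_sum; apply: qval_sum => // s _.
rewrite (qval_coef_sign he).
under eq_bigr do rewrite !mxE addrC.
rewrite bigA_distr coef_sum; apply: qval_sum => // J _.
rewrite (bigID (mem J)) /=.
under eq_bigr => i iJ do rewrite iJ.
under [X in (_ * X)%R]eq_bigr => i /negPf iJ do rewrite iJ.
rewrite prodrN -rmorph_prod -mulrA (qval_coef_sign he).
rewrite coefCM; have [sJ|] := boolP (perm_on J s); last first.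
  case/subsetPn => i; rewrite inE => si iJ.
  rewrite [X in (polyseq X)`_k](bigD1 i) //= eq_sym (negPf si).
  by rewrite mulr0n mul0r coef0 mulr0.
under [X in (polyseq X)`_k]eq_bigr => i iJ do rewrite (out_perm sJ iJ) eqxx mulr1n.
(* The remaining product is a power of ['X] with exponent [n - #|J|], so only sets of cardinal
   [n - k] contribute. *)
rewrite prodr_const coefXn.
have [kJ|_] := eqVneq; last by rewrite mulr0.
rewrite mulr1; apply: cle => //.
by rewrite kJ -[X in (X - _)%N](card_ord n) -(cardC J) addnK.
Qed.

Lemma sum_mine_split (R : realType) (n k : nat) (y : R) (f : 'I_n -> \bar R) :
  \sum_(i < n) mine y%:E (f i) <=
    \sum_(i < n | (i < k)%N) f i + (\sum_(i < n | (k <= i)%N) y)%R%:E.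
Proof.
rewrite (bigID (fun i : 'I_n => (i < k)%N)) /= -sumEFin; apply: leeD.
  by apply: lee_sum => i _; rewrite ge_min lexx orbT.
under eq_bigl do rewrite -leqNgt.
by apply: lee_sum => i _; rewrite ge_min lexx.
Qed.

(* For [y <= v_(k)] the terms of index [>= k] on the left-hand side are all
   equal to [y], and cancel with those on the right-hand side; when
   [v_(k) = +oo], [y] is then taken arbitrarily large. *)
Lemma sum_sorted_le (R : realType) (n : nat) (u v : n.-tuple (\bar R)) :
  sorted <=%O v -> (forall i, tnth v i != -oo) ->
  (forall y : R, \sum_(i < n) mine y%:E (tnth v i)
                   <= \sum_(i < n) mine y%:E (tnth u i)) ->
  forall k, (1 <= k <= n)%N ->
    \sum_(i < n | (i < k)%N) tnth v i <= \sum_(i < n | (i < k)%N) tnth u i.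
Proof.
move=> vs vNy uv k /andP[k0 kn].
have v_le (i j : 'I_n) : (i <= j)%N -> tnth v i <= tnth v j.
  move=> ij; rewrite !(tnth_nth 0).
  apply: (sorted_leq_nth le_trans le_refl) => //; by rewrite inE size_tuple.
set S := \sum_(i < n | _) tnth u i.
have kn' : (k.-1 < n)%N by rewrite prednK.
pose m := Ordinal kn'.
have key (y : R) : y%:E <= tnth v m ->
    \sum_(i < n | (i < k)%N) mine y%:E (tnth v i) <= S.
  move=> yv; have := le_trans (uv y) (sum_mine_split k y (tnth u)).
  rewrite (bigID (fun i : 'I_n => (i < k)%N)) /=.
  under [X in _ + X <= _]eq_bigl do rewrite -leqNgt.
  rewrite [X in _ + X <= _](eq_bigr (fun=> y%:E)); last first.
    move=> i ki; apply/min_idPl/(le_trans yv)/v_le.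
    by rewrite /= (leq_trans (leq_pred k)).
  by rewrite sumEFin leeD2rE.
have [vfin|vm] : (exists z, tnth v m = z%:E) \/ tnth v m = +oo.
  by have := vNy m; case: (tnth v m) => [z||] // _; [left; exists z | right].
- case: vfin => z vz; have := key z; rewrite vz lexx => /(_ isT).
  under eq_bigr => i ik.
    have /min_idPr -> : tnth v i <= z%:E by rewrite -vz v_le //= -ltnS prednK.
    over.
  by [].
- suff -> : S = +oo by rewrite leey.
  (* Truncating at 0 gives finite lower bounds of [min(y, v_i)] valid for all [y >= 0]. As the term
     of index [m] is [y] itself, [S] is at least [C + y], which is unbounded. *)
  pose w i := fine (mine 0 (tnth v i)).
  have wE i : mine 0 (tnth v i) = (w i)%:E.
    rewrite /w; have := vNy i; case: (tnth v i) => [r||] // _.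
      by rewrite -EFin_min.
    by rewrite minEle leey.
  pose C := (\sum_(i < n | (i < k)%N && (i != m)) w i)%R.
  have bound (y : R) : (0 <= y)%R -> (C + y)%:E <= S.
    move=> y0; apply: le_trans (key y _); last by rewrite vm leey.
    rewrite (bigD1 m) /= ?prednK // vm minEle leey EFinD addeC leeD //.
    rewrite -sumEFin; apply: lee_sum => i _.
    by rewrite -wE le_min !ge_min lee_fin y0 /= lexx orbT.
  apply: eq_infty => r.
  apply: le_trans (bound (`|r - C|)%R _); last exact: normr_ge0.
  by rewrite lee_fin -lerBlDl ler_norm.
Qed.

Theorem corollary5p3 (R : realType) (K : comNzRingType) (e : K -> \bar R)
    (he : quasi_valuation e) (n : nat) (M : 'M[K]_n)
    (L : n.-tuple K) (hL : algebraic_eigenvalues M L)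
    (hLdag : forall i : 'I_n, dagger e (tnth L i))
    (Lambda : n.-tuple (\bar R)) (hLambda_sorted : sorted <=%O Lambda)
    (hLambda : perm_eq Lambda [seq e l | l <- L])
    (A : 'M[\bar R]_n) (hA : forall i j : 'I_n, A i j != -oo)
    (heA : forall i j : 'I_n, A i j <= e (M i j))
    (Gamma : n.-tuple (\bar R)) (hGamma : minplus_eigenvalues A Gamma) :
  weakly_majorized Lambda Gamma.
Proof.
have [_ Gs GNy Gval] := hGamma.
have sortK (t : n.-tuple (\bar R)) : sorted <=%O t -> sort_tuple <=%O t = t.
  by move=> ts; apply: val_inj; apply: sort_le_id.
rewrite /weakly_majorized !sortK //; apply: sum_sorted_le => // y.
have [d dE] : exists d, \sum_(i < n) mine y%:E (tnth Gamma i) = d%:E.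
  exists (\sum_(i < n) fine (mine y%:E (tnth Gamma i)))%R.
  rewrite -sumEFin; apply: eq_bigr => i _; have := GNy i.
  case: (tnth Gamma i) => [r||] // _; first by rewrite -EFin_min.
  by rewrite minEle leey.
rewrite -(big_tuple _ _ Lambda predT (mine y%:E)).
rewrite (perm_big _ hLambda) big_map /= dE.
apply: (qval_coef_prodXsubC he) => [l /tnthP[i ->] //|k]; rewrite size_tuple => kn.
have -> : (\prod_(l <- L) ('X - l%:P))%R = char_poly M by rewrite big_tuple hL.
(* The leading coefficient is 0, so [d] is the min-plus characteristic polynomial at [y], hence at
   most its term of index [k]. *)
have := Gval y%:E isT; rewrite dE [X in _ = X + _]/minplus_char_poly eqxx add0e => <-.
have kn1 : (k < n.+1)%N by [].
apply: (le_trans (bigmin_le _ (Ordinal kn1) _)).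
by rewrite EFin_natmul leeD2r // (qval_coef_char_poly (Ordinal kn1) he heA).
Qed.
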